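(* For every integer $t\ge 1$ there is a least positive integer $d(t)$ such that if $P$ is a finite poset whose cover graph has path-width $t$, then $\operatorname{ldim}(P)\le d(t)$.
   Context: All posets are finite. The cover graph of a poset $P$ is the graph on the ground set of $P$ in which $x,y$ are adjacent iff one covers the other. A partial linear extension (ple) of $P$ is a linear extension of a subposet of $P$ (i.e., a linear order on a subset $S$ of the ground set extending the restriction of $P$ to $S$). For a family $\mathcal{L}$ of ple's and $u\in P$, $\mu(u,\mathcal{L})$ is the number of members of $\mathcal{L}$ containing $u$, and $\mu(\mathcal{L})=\max_u\mu(u,\mathcal{L})$. A non-empty family $\mathcal{L}$ of ple's is a local realizer of $P$ if (1) whenever $x\le y$ in $P$ there is $L\in\mathcal{L}$ with $x\le y$ in $L$, and (2) whenever $x,y$ are incomparable in $P$ there is $L\in\mathcal{L}$ with $x>y$ in $L$. The local dimension $\operatorname{ldim}(P)$ is the minimum of $\mu(\mathcal{L})$ over local realizers $\mathcal{L}$ of $P$. Path-width is the usual graph parameter: the minimum over path-decompositions of the maximum bag size minus one. *)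

(* Defs.v *)
From HB Require Import structures.
From mathcomp Require Import all_boot all_order.
From mathcomp Require Import boolp.

Set Implicit Arguments.
Unset Strict Implicit.
Unset Printing Implicit Defensive.

Import Order.TTheory.
Local Open Scope order_scope.

Lemma asbool_ex (Q : nat -> Prop) : (exists n, Q n) -> exists n, `[< Q n >].
Proof. by case=> n Qn; exists n; apply/asboolP. Qed.

Definition min_nat (Q : nat -> Prop) (exQ : exists n, Q n) : nat :=
  ex_minn (asbool_ex exQ).

Lemma min_natP (Q : nat -> Prop) (exQ : exists n, Q n) :
  Q (min_nat exQ) /\ forall n, Q n -> (min_nat exQ <= n)%N.
Proof.
rewrite /min_nat; case: ex_minnP => m /asboolP Qm min_m.
by split=> // n Qn; apply/min_m/asboolP.
Qed.

Definition covered_by (disp : Order.disp_t) (P : finPOrderType disp) : rel P :=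
  fun x y => (x < y) && ~~ [exists z, x < z < y].

Definition cover_graph (disp : Order.disp_t) (P : finPOrderType disp) : rel P :=
  fun x y => covered_by x y || covered_by y x.

Definition path_decomposition (V : finType) (e : rel V) (B : seq {set V}) :
    Prop :=
  [/\ forall v, exists2 i, (i < size B)%N & v \in nth set0 B i,
      forall u v, e u v ->
        exists2 i, (i < size B)%N & (u \in nth set0 B i) && (v \in nth set0 B i)
    & forall v i j k, (i <= j <= k)%N -> (k < size B)%N ->
        v \in nth set0 B i -> v \in nth set0 B k -> v \in nth set0 B j].

(* The predecessor is truncated, so the empty graph gets path-width 0
   instead of -1. *)
Definition width (V : finType) (B : seq {set V}) : nat :=
  (\max_(b <- B) #|b|)%N.-1.

Lemma path_decomposition_exists (V : finType) (e : rel V) :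
  exists n, exists2 B, path_decomposition e B & width B = n.
Proof.
exists (width [:: [set: V]]), [:: [set: V]] => //; split.
- by move=> v; exists 0%N => //=; rewrite inE.
- by move=> u v _; exists 0%N => //=; rewrite !inE.
- move=> v i j k /andP[_ le_jk]; rewrite /= ltnS leqn0 => /eqP k0.
  by move: le_jk; rewrite k0 leqn0 => /eqP-> /= _; rewrite inE.
Qed.

Definition pathwidth (V : finType) (e : rel V) : nat :=
  min_nat (path_decomposition_exists e).

(* A linear order on a subset S of P is encoded as the duplicate-free sequence
   listing S in increasing order. *)
Definition ple_le (T : eqType) (L : seq T) : rel T :=
  fun x y => [&& x \in L, y \in L & (index x L <= index y L)%N].

Definition ple_lt (T : eqType) (L : seq T) : rel T :=
  fun x y => [&& x \in L, y \in L & (index x L < index y L)%N].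

Definition is_ple (disp : Order.disp_t) (P : finPOrderType disp) (L : seq P) :
    Prop :=
  uniq L /\ {in L &, forall x y : P, x <= y -> ple_le L x y}.

(* Families are sequences, so repeated members count with multiplicity. *)
Definition mu_at (T : eqType) (u : T) (F : seq (seq T)) : nat :=
  count (fun L => u \in L) F.

Definition mu (T : finType) (F : seq (seq T)) : nat :=
  (\max_(u : T) mu_at u F)%N.

Definition local_realizer (disp : Order.disp_t) (P : finPOrderType disp)
    (F : seq (seq P)) : Prop :=
  [/\ F <> [::],
      forall L, L \in F -> is_ple L,
      forall x y : P, x <= y -> exists2 L, L \in F & ple_le L x y
    & forall x y : P, x >< y -> exists2 L, L \in F & ple_lt L y x].

Lemma local_realizer_exists (disp : Order.disp_t) (P : finPOrderType disp) :
  exists n, exists2 F : seq (seq P), local_realizer F & mu F = n.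
Proof.
pose F : seq (seq P) := [::] :: [seq [:: x] | x <- enum P] ++
  [seq [:: p.1; p.2] | p <- enum [pred p : P * P | ~~ (p.2 <= p.1)]].
have in1 x : [:: x] \in F.
  by rewrite inE mem_cat (map_f (fun x => [:: x])) ?mem_enum ?orbT.
have in2 (x y : P) : ~~ (y <= x) -> [:: x; y] \in F.
  move=> nyx; rewrite inE mem_cat.
  by rewrite (map_f (fun p : P * P => [:: p.1; p.2]) (x := (x, y)))
             ?mem_enum ?orbT.
have lt2 (x y : P) : x != y -> ple_lt [:: x; y] x y.
  by move=> /negbTE nxy; rewrite /ple_lt !inE !eqxx orbT /= eqxx nxy.
have leW L (x y : P) : ple_lt L x y -> ple_le L x y.
  by case/and3P=> ? ? /ltnW ?; apply/and3P.
exists (mu F), F => //; split=> //.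
- move=> L; rewrite inE mem_cat => /orP[/eqP-> //|/orP[]].
    case/mapP=> x _ ->; split=> // a b; rewrite !inE => /eqP-> /eqP-> _.
    by rewrite /ple_le !inE eqxx /=.
  case/mapP=> -[x y]; rewrite mem_enum inE /= => nyx ->.
  have nxy : x != y by apply: contraNneq nyx => ->.
  split; first by rewrite /= inE nxy.
  move=> a b; rewrite !inE => /orP[]/eqP-> /orP[]/eqP-> le_ab.
  + by rewrite /ple_le !inE eqxx leqnn.
  + exact/leW/lt2.
  + by rewrite le_ab in nyx.
  + by rewrite /ple_le !inE eqxx orbT leqnn.
- move=> x y le_xy; have [->|nxy] := eqVneq x y.
    by exists [:: y] => //; rewrite /ple_le inE eqxx leqnn.
  exists [:: x; y]; last exact/leW/lt2.
  by apply: in2; apply: contra nxy => le_yx; rewrite eq_le le_xy.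
- move=> x y; rewrite /Order.comparable negb_or => /andP[nxy _].
  exists [:: y; x]; first exact: in2.
  by apply: lt2; apply: contraNneq nxy => ->.
Qed.

Definition ldim (disp : Order.disp_t) (P : finPOrderType disp) : nat :=
  min_nat (local_realizer_exists P).

Definition ldim_bound (t d : nat) : Prop :=
  forall (disp : Order.disp_t) (P : finPOrderType disp),
    pathwidth (@cover_graph disp P) = t -> (ldim P <= d)%N.

(* Main.v *)
Require Import Defs.
From mathcomp Require Import all_boot all_order.

Set Implicit Arguments.
Unset Strict Implicit.
Import Order.TTheory.

(** For each element [x] fix one bag [B (h x)] containing it, and let [U j x] be
    the set of upper bounds of [x] in the bag [B j]. A comparability between
    elements on either side of a bag passes through that bag. So if
    [h x <= h y], then [x <= y] iff [y \in U (h y) x]; and if [U i x = U i x'],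
    then [U j x = U j x'] for all [j >= i]. Thus the classes of elements with
    equal [U j] only merge as [j] grows, and there are at most [2 ^ (t + 1)] of
    them at any time. Name each class by its member [n] with the smallest [h];
    let the ple of [n] consist of those [z] such that [n] still names a class at
    time [h z], and sort it decreasingly by the first time at which some element
    below [z] has joined the class of [n]. Then each [z] lies in at most
    [2 ^ (t + 1)] of these ples, and if [h x <= h y] and not [x <= y], then [x]
    is above [y] in the ple of the name of [x] at time [h y]. The dual poset
    takes care of the pairs with [h y <= h x]. *)

(** * First index of an upward closed predicate, as a count of its failures *)

Lemma count_leq (q : pred nat) (m j : nat) :
    (forall i k, i <= k -> q i -> q k) -> q j ->
  count (predC q) (iota 0 m) <= j.
Proof.
move=> qW qj; rewrite -size_filter -[leqRHS](size_iota 0).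
apply: uniq_leq_size; first by rewrite filter_uniq ?iota_uniq.
move=> i; rewrite mem_filter !mem_iota /= !add0n => /andP[nqi _].
by rewrite ltnNge; apply: contra nqi => /qW; apply.
Qed.

Lemma count_ltn (q : pred nat) (m j : nat) :
    (forall i k, i <= k -> q i -> q k) -> j < m -> ~~ q j ->
  j < count (predC q) (iota 0 m).
Proof.
move=> qW lt_jm nqj; rewrite -size_filter -[leqLHS](size_iota 0).
apply: uniq_leq_size; first exact: iota_uniq.
move=> i; rewrite mem_filter !mem_iota /= !add0n ltnS => le_ij.
by rewrite (leq_ltn_trans le_ij lt_jm) andbT; apply: contra nqj; apply: qW.
Qed.

(** * Class leaders, for a relation later taken to be the order or its dual *)

Section Leaders.
Variables (T : finType) (le : rel T) (B : nat -> {set T}) (h : T -> nat).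
Variable m : nat.
Hypotheses (le_trans : transitive le) (hB : forall x, x \in B (h x)).
Hypothesis hm : forall x, h x < m.
Hypothesis cross : forall x y j k, le x y -> y \in B j -> h x <= k <= j ->
  exists2 b, b \in B k & le x b && le b y.

Definition bag_up j x := [set b in B j | le x b].

(* The second summand only breaks ties, making [rho] injective. *)
Definition rho x := h x * #|T| + enum_rank x.

Definition leader j n :=
  (h n <= j) &&
  [forall x, (h x <= j) && (bag_up j x == bag_up j n) ==> (rho n <= rho x)].

Definition joined n z j :=
  [exists a, [&& le a z, h a <= j, h n <= j & bag_up j a == bag_up j n]].

(** Since [joined n z] persists in time, this is the first time at which it holds, or [m] if it
    fails at all times below [m]. *)
Definition join_time n z := count (predC (joined n z)) (iota 0 m).

Lemma rho_inj : injective rho.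
Proof.
move=> x y; rewrite /rho => e; apply/enum_rank_inj/val_inj => /=.
by rewrite -(modn_small (ltn_ord (enum_rank x)))
  -(modn_small (ltn_ord (enum_rank y))) -(modnMDl (h x)) e modnMDl.
Qed.

Lemma leq_rho_h x y : rho x <= rho y -> h x <= h y.
Proof.
have T0 : 0 < #|T| by apply/card_gt0P; exists x.
move/(leq_div2r #|T|); rewrite /rho !divnMDl //.
by rewrite !(divn_small (ltn_ord _)) !addn0.
Qed.

(** An upper bound of [u] in [B j] is reached through some [c] in [B i]; as [c] is also above [v],
    so is that bound. *)
Lemma bag_up_merge i j x y : h x <= i -> h y <= i -> i <= j ->
  bag_up i x = bag_up i y -> bag_up j x = bag_up j y.
Proof.
move=> hx hy ij; suff sub u v : h u <= i -> bag_up i u = bag_up i v ->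
    bag_up j u \subset bag_up j v.
  by move=> e; apply/eqP; rewrite eqEsubset !sub.
move=> hu e; apply/subsetP => b; rewrite !inE => /andP[Bb le_ub].
have [|c Bc /andP[uc cb]] := cross (k := i) le_ub Bb; first by rewrite hu.
have : c \in bag_up i u by rewrite inE Bc.
by rewrite e inE Bb => /andP[_ vc]; exact: le_trans cb.
Qed.

Lemma leader_exists x j : h x <= j ->
  exists n, [/\ leader j n, rho n <= rho x & bag_up j n = bag_up j x].
Proof.
move=> hx; pose p n := (h n <= j) && (bag_up j n == bag_up j x).
have px : p x by rewrite /p hx eqxx.
case: (arg_minnP rho px) => n /andP[hn /eqP en] min_n.
exists n; split => //; last exact: min_n.
rewrite /leader hn; apply/forallP => z; apply/implyP; rewrite en.
exact: min_n.
Qed.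

(** Two leaders with equal [bag_up j] have equal [rho], so [bag_up j] maps leaders injectively to
    subsets of [B j]. *)
Lemma card_leader j : #|[pred n | leader j n]| <= 2 ^ #|B j|.
Proof.
rewrite -card_powerset -(card_in_imset (f := bag_up j)).
  apply/subset_leq_card/subsetP => _ /imsetP[n _ ->].
  by rewrite inE; apply/subsetP => b; rewrite inE => /andP[].
move=> x y /andP[hx /forallP lx] /andP[hy /forallP ly] e; apply: rho_inj.
apply/eqP; rewrite eqn_leq; have := lx y; have := ly x.
by rewrite hx hy e eqxx /= => -> ->.
Qed.

Lemma joined_mono n z i k : i <= k -> joined n z i -> joined n z k.
Proof.
move=> ik /existsP[a /and4P[az ha hn /eqP e]]; apply/existsP; exists a.
by rewrite az !(leq_trans _ ik) //= (bag_up_merge ha hn ik e).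
Qed.

Lemma join_time_anti n x y : le x y -> join_time n y <= join_time n x.
Proof.
move=> xy; apply: sub_count => j /=; apply: contra => /existsP[a].
case/and4P=> ax ha hn e; apply/existsP; exists a.
by rewrite (le_trans ax xy) ha hn e.
Qed.

Lemma leader_separates x y : le x x -> h x <= h y -> ~~ le x y ->
  exists n, [/\ leader (h x) n, leader (h y) n & join_time n x < join_time n y].
Proof.
move=> xx hxy nxy; have [n [ln rn en]] := leader_exists hxy.
have hn := leq_rho_h rn; exists n; split=> //.
  (* A rival of [n] at time [h x] is still in its class at time [h y], where [n] is minimal. *)
  rewrite /leader hn; apply/forallP => z; apply/implyP => /andP[hz /eqP ez].
  have /andP[_ /forallP/(_ z)/implyP] := ln; apply.
  by rewrite (leq_trans hz hxy) (bag_up_merge hz hn hxy ez) eqxx.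
(* Time [h y] separates the two: [x] itself witnesses that [x] has joined by then, whereas an [a]
   below [y] in the class of [x] would put [y] in [bag_up (h y) x]. *)
apply: (@leq_ltn_trans (h y)).
  apply: count_leq; first exact: joined_mono.
  by apply/existsP; exists x; rewrite xx hxy (leq_trans hn hxy) en eqxx.
apply: count_ltn => //; first exact: joined_mono.
apply: contra nxy => /existsP[a /and4P[ay _ _ /eqP e]].
have : y \in bag_up (h y) a by rewrite inE hB.
by rewrite e en inE => /andP[].
Qed.

End Leaders.

(** * Ples sorted by a monotone key *)

Section PosetPles.
Local Open Scope order_scope.
Variables (disp : Order.disp_t) (P : finPOrderType disp).
Implicit Types (S : {set P}) (key : P -> nat).

(* The size of the down-set makes the key strictly increasing. *)
Definition refined_key key x := (key x * #|P|.+1 + #|[pred z | (z <= x)%O]|)%N.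

Definition key_ple S key : seq P :=
  sort (relpre (refined_key key) leq) (enum S).

Lemma mem_key_ple S key x : (x \in key_ple S key) = (x \in S).
Proof. by rewrite mem_sort mem_enum. Qed.

Lemma refined_key_lt key x y :
  (key x < key y)%N -> (refined_key key x < refined_key key y)%N.
Proof.
move=> kxy; rewrite /refined_key.
(* A down-set has at most [#|P|] elements, too few to offset a unit of [key]. *)
apply: (@leq_trans ((key x).+1 * #|P|.+1)%N).
  by rewrite mulSn addnC ltn_add2r ltnS max_card.
by rewrite (leq_trans _ (leq_addr _ _)) // leq_mul2r kxy orbT.
Qed.

Lemma refined_key_ple_lt S key x y : x \in S -> y \in S ->
  (refined_key key x < refined_key key y)%N -> ple_lt (key_ple S key) x y.
Proof.
move=> Sx Sy lt_xy; rewrite /ple_lt !mem_key_ple Sx Sy /= ltnNge leq_eqVlt.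
apply/negP => /orP[/eqP e|lt_yx].
  suff yx : y = x by rewrite yx ltnn in lt_xy.
  by apply: (index_inj x _ _ e); rewrite mem_key_ple.
have le_tr : transitive (relpre (refined_key key) leq).
  by move=> v u w; apply: leq_trans.
have /(sorted_ltn_index le_tr)/(_ y x) :
    sorted (relpre (refined_key key) leq) (key_ple S key).
  by apply: sort_sorted => u v; apply: leq_total.
by rewrite !mem_key_ple Sx Sy => /(_ isT isT lt_yx) /=; rewrite leqNgt lt_xy.
Qed.

Lemma key_ple_lt S key x y : x \in S -> y \in S -> (key x < key y)%N ->
  ple_lt (key_ple S key) x y.
Proof. by move=> Sx Sy /refined_key_lt; apply: refined_key_ple_lt. Qed.

Lemma key_ple_is_ple S key :
  (forall x y : P, x <= y -> (key x <= key y)%N) -> is_ple (key_ple S key).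
Proof.
move=> key_mono; split; first by rewrite sort_uniq enum_uniq.
move=> x y; rewrite !mem_key_ple => Sx Sy.
rewrite le_eqVlt => /orP[/eqP->|lt_xy].
  by rewrite /ple_le !mem_key_ple Sy leqnn.
have /and3P[xL yL /ltnW] : ple_lt (key_ple S key) x y.
  apply: refined_key_ple_lt => //; have := key_mono _ _ (ltW lt_xy).
  rewrite leq_eqVlt => /orP[/eqP e|]; last exact: refined_key_lt.
  rewrite /refined_key e ltn_add2l; apply/proper_card/properP; split.
    by apply/subsetP => z; rewrite !inE => /le_trans; apply; apply: ltW.
  by exists y; rewrite !inE ?lexx // lt_geF.
by move=> le_i; apply/and3P.
Qed.

End PosetPles.

(** * Bag sizes, and comparabilities passing through bags *)

Lemma card_bag_width (V : finType) (Bs : seq {set V}) i :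
  #|nth set0 Bs i| <= (width Bs).+1.
Proof.
have [lt_i|le_i] := ltnP i (size Bs); last by rewrite nth_default ?cards0.
apply: (@leq_trans (\max_(b <- Bs) #|b|)); last by rewrite /width leqSpred.
by apply: leq_bigmax_seq => //; apply: mem_nth.
Qed.

Section Crossing.
Local Open Scope order_scope.
Variables (disp : Order.disp_t) (P : finPOrderType disp).

(** Among the elements above [x] and at most [y], one with the smallest down-set covers [x]. *)
Lemma covered_by_le (x y : P) : x < y -> exists2 z, covered_by x z & z <= y.
Proof.
move=> lt_xy; pose p z := (x < z) && (z <= y).
have py : p y by rewrite /p lt_xy lexx.
case: (arg_minnP (fun z => #|[pred u | (u <= z)%O]|) py).
move=> z /andP[xz zy] min_z.
exists z => //; rewrite /covered_by xz; apply/existsP => -[u /andP[xu uz]].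
have := min_z u; rewrite /p xu (le_trans (ltW uz) zy) => /(_ isT).
rewrite leqNgt => /negP; apply; apply/proper_card/properP; split.
  by apply/subsetP => v; rewrite !inE => /le_trans; apply; apply: ltW.
by exists z; rewrite !inE ?lexx // lt_geF.
Qed.

Variable Bs : seq {set P}.
Hypothesis decB : path_decomposition (@cover_graph disp P) Bs.

Lemma bag_convex v i j k : (i <= k <= j)%N || (j <= k <= i)%N ->
  v \in nth set0 Bs i -> v \in nth set0 Bs j -> v \in nth set0 Bs k.
Proof.
have in_bag l : v \in nth set0 Bs l -> (l < size Bs)%N.
  by rewrite ltnNge; apply: contraL => le_l; rewrite nth_default ?inE.
have [_ _ conv] := decB; case/orP=> ikj vi vj.
  exact: conv ikj (in_bag _ vj) vi vj.
exact: conv ikj (in_bag _ vi) vj vi.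
Qed.

(** Climb from [x] to [y] by covers: consecutive elements share a bag, so the climb cannot jump over
    bag [k]. The induction is on the number of elements above [x]. *)
Lemma bag_crossing (x y : P) i j k : x <= y ->
    x \in nth set0 Bs i -> y \in nth set0 Bs j ->
    (i <= k <= j)%N || (j <= k <= i)%N ->
  exists2 b, b \in nth set0 Bs k & (x <= b) && (b <= y).
Proof.
have [n] := ubnP #|[pred z | x < z]|; elim: n x i => // n IHn x i lt_n.
rewrite le_eqVlt => /orP[/eqP-> yi yj ikj|lt_xy xi yj ikj].
  by exists y; [apply: bag_convex yi yj | rewrite lexx].
have [z cov_xz zy] := covered_by_le lt_xy.
have lt_xz : x < z by case/andP: cov_xz.
have [_ edge _] := decB.
have [|l _ /andP[xl zl]] := edge x z; first by rewrite /cover_graph cov_xz.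
have [ikl|] := boolP ((i <= k <= l)%N || (l <= k <= i)%N).
  by exists x; [apply: bag_convex xi xl | rewrite lexx ltW].
(* Bag [k] is not between [i] and [l], so it is between [l] and [j], and the climb continues from
   [z]. *)
move=> nikl; have lkj : (l <= k <= j)%N || (j <= k <= l)%N.
  case/orP: ikj nikl => /andP[-> ->]; rewrite ?andbT ?andTb /= negb_or.
    by rewrite -ltnNge => /andP[/ltnW-> _].
  by rewrite andbC -ltnNge => /andP[/ltnW-> _]; rewrite orbT.
have [|b bk /andP[zb by_]] := IHn z l _ zy zl yj lkj.
  move: lt_n; rewrite ltnS; apply: leq_trans; apply/proper_card/properP; split.
    by apply/subsetP => v; rewrite !inE; apply: lt_trans.
  by exists z; rewrite !inE ?ltxx.
by exists b => //; rewrite (le_trans (ltW lt_xz)).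
Qed.

End Crossing.

(** * Assembling the local realizer *)

Section Realizer.
Local Open Scope order_scope.
Variables (disp : Order.disp_t) (P : finPOrderType disp).

Lemma ldim_le_mu (F : seq (seq P)) : local_realizer F -> (ldim P <= mu F)%N.
Proof.
move=> realF; have [_ ldim_min] := min_natP (local_realizer_exists P).
by apply: ldim_min; exists F.
Qed.

(** If [x < y] then [y <= x] fails, so reversing all failing pairs also realizes the strict
    comparabilities. *)
Lemma local_realizer_rev_pairs (F : seq (seq P)) : F <> [::] ->
    (forall L, L \in F -> is_ple L) ->
    (forall x, exists2 L, L \in F & x \in L) ->
    (forall x y, ~~ (x <= y) -> exists2 L, L \in F & ple_lt L y x) ->
  local_realizer F.
Proof.
move=> F0 pleF coverF revF; split=> //.
  move=> x y; rewrite le_eqVlt => /orP[/eqP->|lt_xy].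
    by have [L FL yL] := coverF y; exists L; rewrite // /ple_le yL leqnn.
  have [|L FL /and3P[xL yL /ltnW ?]] := revF y x; first by rewrite lt_geF.
  by exists L => //; apply/and3P.
by move=> x y; rewrite /Order.comparable negb_or => /andP[/revF].
Qed.

Lemma ldim_le_width (Bs : seq {set P}) :
  path_decomposition (@cover_graph disp P) Bs ->
  (ldim P <= 2 * 2 ^ (width Bs).+1)%N.
Proof.
move=> decB; pose B := nth set0 Bs; pose m := size Bs.
pose h x := find (fun b : {set P} => x \in b) Bs.
have hasB x : has (fun b : {set P} => x \in b) Bs.
  have [vB _ _] := decB; have [i lt_i xi] := vB x.
  by apply/hasP; exists (nth set0 Bs i) => //; apply: mem_nth.
have hB x : x \in B (h x) by apply: (nth_find set0 (hasB x)).
have hm x : (h x < m)%N by rewrite -has_find.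
pose le_ := fun x y : P => x <= y; pose ge_ := fun x y : P => y <= x.
have le_tr : transitive le_ by move=> y x z; apply: le_trans.
have ge_tr : transitive ge_ by move=> y x z xy yz; apply: le_trans yz xy.
have le_cross x y j k : le_ x y -> y \in B j -> (h x <= k <= j)%N ->
    exists2 b, b \in B k & le_ x b && le_ b y.
  move=> xy yj hkj.
  by apply: (bag_crossing decB xy (hB x) yj) => //; rewrite hkj.
have ge_cross x y j k : ge_ x y -> y \in B j -> (h x <= k <= j)%N ->
    exists2 b, b \in B k & ge_ x b && ge_ b y.
  move=> yx yj hkj; rewrite /ge_.
  have [|b bk /andP[yb bx]] := bag_crossing (k := k) decB yx yj (hB x).
    by rewrite hkj orbT.
  by exists b => //; rewrite bx.
pose S (r : rel P) n := [set z | leader r B h (h z) n].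
pose jt (r : rel P) := join_time r B h m.
have jt_m r n z : (jt r n z <= m)%N.
  by rewrite (leq_trans (count_size _ _)) ?size_iota.
(* Join times decrease along [r]: they are complemented in [m] for the order and used as they are
   for the dual. *)
pose up n := key_ple (S le_ n) (fun z => m - jt le_ n z)%N.
pose dn n := key_ple (S ge_ n) (jt ge_ n).
(* [[::]] keeps the family non-empty when [P] is empty. *)
pose F := [::] :: map up (enum P) ++ map dn (enum P).
have upF n : up n \in F by rewrite inE mem_cat map_f ?mem_enum ?orbT.
have dnF n : dn n \in F by rewrite inE mem_cat (map_f dn) ?mem_enum ?orbT.
have card_S r u :
    (count (fun n => u \in S r n) (enum P) <= 2 ^ (width Bs).+1)%N.
  rewrite (eq_count (a2 := leader r B h (h u))) => [|n]; last by rewrite inE.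
  rewrite -size_filter enumT -/(enum_mem _) -cardE.
  apply: leq_trans (card_leader r B h (h u)) _.
  by rewrite leq_exp2l // card_bag_width.
(* The ples of one kind containing [u] belong to the leaders at time [h u]; the two kinds give the
   factor 2. *)
apply: (@leq_trans (mu F)); last first.
  apply/bigmax_leqP => u _; rewrite /mu_at /F -cat1s 2!count_cat.
  rewrite (count_map up) (count_map dn).
  rewrite (_ : count _ [:: [::]] = 0)%N // add0n mul2n -addnn.
  apply: leq_add.
    apply: leq_trans (card_S le_ u).
    by apply: sub_count => n /=; rewrite mem_key_ple.
  apply: leq_trans (card_S ge_ u).
  by apply: sub_count => n /=; rewrite mem_key_ple.
apply/ldim_le_mu/local_realizer_rev_pairs => //.
- move=> L; rewrite inE mem_cat => /orP[/eqP-> //|/orP[]/mapP[n _ ->]].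
    apply: key_ple_is_ple => x y xy; apply: leq_sub2l.
    exact: join_time_anti.
  by apply: key_ple_is_ple => x y xy; apply: join_time_anti.
- move=> x; have [n [ln _ _]] := leader_exists le_ B (leqnn (h x)).
  by exists (up n); rewrite // mem_key_ple inE.
- move=> x y nxy; have [hxy|/ltnW hyx] := leqP (h x) (h y).
    have [n [lx ly lt_j]] :=
      leader_separates le_tr hB hm le_cross (lexx x) hxy nxy.
    exists (up n) => //; apply: key_ple_lt; rewrite ?inE //.
    (* Truncated subtraction stays strict here because join times are at most [m]. *)
    by apply: ltn_sub2l (lt_j); apply: leq_trans lt_j (jt_m _ _ _).
  have [n [ly lx lt_j]] :=
      leader_separates ge_tr hB hm ge_cross (lexx y) hyx nxy.
  by exists (dn n) => //; apply: key_ple_lt; rewrite ?inE.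
Qed.

End Realizer.

Theorem theorem5p1 (t : nat) (ht : 1 <= t) :
  exists d : nat,
    [/\ 0 < d,
        ldim_bound t d
      & forall d' : nat, 0 < d' -> ldim_bound t d' -> d <= d'].
Proof.
(* Any positive bound suffices, as [min_nat] then selects the least one. *)
have exd : exists d, 0 < d /\ ldim_bound t d.
  exists (2 * 2 ^ t.+1); split; first by rewrite muln_gt0 expn_gt0.
  move=> disp P pwP.
  have [[B decB wB] _] :=
    min_natP (path_decomposition_exists (@cover_graph disp P)).
  have -> : t = width B by rewrite wB -pwP.
  exact: ldim_le_width.
have [[d_gt0 d_bound] d_min] := min_natP exd.
by exists (min_nat exd); split=> // d' *; apply: d_min.
Qed.
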